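(* Let $m\geq 4$ and $n\geq 9$ be integers with $n\notin\{10,12,14,16\}$. Let $A$ be a set of $m$ alternatives and $N=\{1,\dots,n\}$ a set of $n$ voters. Then there is no social welfare function $f:\mathcal{R}^N\to\mathcal{R}$ that is both strategyproof and majority consistent.
   Context: A ranking on $A$ is a complete, transitive, antisymmetric binary relation on $A$ (a linear order); $\mathcal{R}$ denotes the set of all rankings on $A$. Throughout, comparisons $x\succ y$ are understood between distinct alternatives. A profile is a tuple $R=(\succ_1,\dots,\succ_n)\in\mathcal{R}^N$ giving one ranking $\succ_i$ for each voter $i\in N$. A social welfare function (SWF) is a function $f:\mathcal{R}^N\to\mathcal{R}$. Kemeny distance: for rankings $\succ,\rhd$, $\Delta(\succ,\rhd)=|\{(x,y)\in A^2: x\succ y \text{ and } y\rhd x\}|$ (the number of pairs of distinct alternatives on which the two rankings disagree). Strategyproofness: $f$ is strategyproof if $\Delta(\succ_i,f(R))\leq\Delta(\succ_i,f(R'))$ for all voters $i\in N$ and all profiles $R=(\succ_1,\dots,\succ_n)$, $R'=(\succ_1',\dots,\succ_n')$ in $\mathcal{R}^N$ such that $\succ_j=\succ_j'$ for all $j\in N\setminus\{i\}$. Majority consistency: the majority relation $\succsim_R$ of a profile $R$ is defined by $x\succsim_R y$ if and only if $|\{i\in N: x\succ_i y\}|\geq|\{i\in N: y\succ_i x\}|$. The SWF $f$ is majority consistent if $f(R)=\succsim_R$ for every profile $R\in\mathcal{R}^N$ for which $\succsim_R$ is transitive and antisymmetric (i.e., is a ranking). *)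

(* Defs.v *)
From HB Require Import structures.
From mathcomp Require Import all_boot.

Set Implicit Arguments.
Unset Strict Implicit.
Unset Printing Implicit Defensive.

(** Rankings are stored as reflexive linear orders: [total] includes [r x x].
    The strict comparison of distinct alternatives is [prefers] below. *)
Definition rel_of_set (A : finType) (S : {set A * A}) : rel A :=
  fun x y => (x, y) \in S.

Definition is_ranking (A : finType) (S : {set A * A}) : bool :=
  [&& [forall x, forall y, rel_of_set S x y || rel_of_set S y x],
      [forall x, forall y, rel_of_set S x y && rel_of_set S y x ==> (x == y)]
    & [forall y, forall x, forall z,
         rel_of_set S x y ==> rel_of_set S y z ==> rel_of_set S x z]].

Lemma is_rankingP (A : finType) (S : {set A * A}) :
  reflect [/\ total (rel_of_set S), antisymmetric (rel_of_set S)
            & transitive (rel_of_set S)]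
          (is_ranking S).
Proof.
apply: (iffP and3P) => -[tot anti tr]; split.
- by move=> x y; move/forallP/(_ x)/forallP: tot; apply.
- by move=> x y xy; move/forallP/(_ x)/forallP/(_ y)/implyP/(_ xy)/eqP: anti.
- move=> y x z xy yz.
  by move/forallP/(_ y)/forallP/(_ x)/forallP/(_ z): tr; rewrite xy yz.
- by apply/forallP => x; apply/forallP => y; apply: tot.
- by apply/forallP => x; apply/forallP => y; apply/implyP => /anti ->.
- apply/forallP => y; apply/forallP => x; apply/forallP => z.
  by apply/implyP => xy; apply/implyP; apply: tr xy.
Qed.

Record ranking (A : finType) := Ranking {
  ranking_set :> {set A * A};
  ranking_setP : is_ranking ranking_set
}.

HB.instance Definition _ (A : finType) := [isSub for @ranking_set A].
HB.instance Definition _ (A : finType) := [Finite of ranking A by <:].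

Definition prefers (A : finType) (r : ranking A) (x y : A) : bool :=
  (x != y) && rel_of_set r x y.

Definition profile (A : finType) (n : nat) := {ffun 'I_n -> ranking A}.

Definition swf (A : finType) (n : nat) := profile A n -> ranking A.

Definition kemeny (A : finType) (r s : ranking A) : nat :=
  #|[set p : A * A | prefers r p.1 p.2 && prefers s p.2 p.1]|.

Definition strategyproof (A : finType) (n : nat) (f : swf A n) : Prop :=
  forall (i : 'I_n) (R R' : profile A n),
    (forall j : 'I_n, j != i -> R j = R' j) ->
    kemeny (R i) (f R) <= kemeny (R i) (f R').

Definition majority (A : finType) (n : nat) (R : profile A n) : rel A :=
  fun x y => #|[set i : 'I_n | prefers (R i) y x]|
             <= #|[set i : 'I_n | prefers (R i) x y]|.

(** [majority R] is always total, so the two hypotheses say that it is a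
    ranking. *)
Definition majority_consistent (A : finType) (n : nat) (f : swf A n) : Prop :=
  forall R : profile A n,
    transitive (majority R) -> antisymmetric (majority R) ->
    rel_of_set (f R) =2 majority R.

(* Main.v *)
Require Import Defs.
From mathcomp Require Import all_boot.
From mathcomp Require Import zify.

(** Fix four alternatives a, b, c, d and let the other ones be ranked last, in
    one fixed order, by every voter that matters. There is a nine-voter profile W
    with an intransitive majority relation from which single voters can deviate
    to profiles whose majority relation is a ranking, where the outcome is known.
    Strategyproofness for these deviations, used in both directions, forces the
    outcome cdab at W. When the voter with ranking cadb changes it to cabd, the
    outcome is likewise forced to be bcda. A voter whose true ranking is cabd
    then gains by reporting cadb, since cabd is at distance 2 from cdab and 3
    from bcda.

    For other electorates each of the nine voters is cloned once (n odd) or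
    twice (n even, n >= 18), and pairs of opposite voters are added. *)

Set Implicit Arguments.
Unset Strict Implicit.
Unset Printing Implicit Defensive.

(** * Rankings given by lists, and their opposites *)

Lemma prefers_total (A : finType) (r : ranking A) (x y : A) :
  x != y -> prefers r y x = ~~ prefers r x y.
Proof.
move=> xy; rewrite /prefers xy eq_sym xy /=.
have /is_rankingP[tot anti _] := ranking_setP r.
case rxy: (rel_of_set r x y); case ryx: (rel_of_set r y x) => //.
  by move: xy; rewrite (anti x y) ?eqxx // rxy ryx.
by move: (tot x y); rewrite rxy ryx.
Qed.

Lemma ranking_ext (A : finType) (r s : ranking A) :
  rel_of_set r =2 rel_of_set s -> r = s.
Proof. by move=> rs; apply/val_inj/setP => -[x y]; apply: rs. Qed.

(** Appending [enum A] gives every alternative a position: those missing from [s] follow in the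
    order of [enum A], and repetitions are harmless because [index] finds the first occurrence. *)
Lemma rank_set_is_ranking (A : finType) (s : seq A) :
  is_ranking [set p : A * A |
    index p.1 (s ++ enum A) <= index p.2 (s ++ enum A)].
Proof.
apply/is_rankingP; rewrite /rel_of_set; split.
- by move=> x y; rewrite !inE; apply: leq_total.
- move=> x y; rewrite !inE /= -eqn_leq => /eqP.
  by apply: index_inj; rewrite // mem_cat mem_enum orbT.
- by move=> y x z; rewrite !inE; apply: leq_trans.
Qed.

Definition rank_of (A : finType) (s : seq A) : ranking A :=
  Ranking (rank_set_is_ranking s).

Lemma prefers_rank_of (A : finType) (s : seq A) (x y : A) :
  prefers (rank_of s) x y = (index x (s ++ enum A) < index y (s ++ enum A)).
Proof.
rewrite /prefers /rel_of_set inE /= ltn_neqAle; congr (~~ _ && _).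
apply/eqP/eqP => [-> //|].
by apply: index_inj; rewrite // mem_cat mem_enum orbT.
Qed.

Lemma opposite_is_ranking (A : finType) (r : ranking A) :
  is_ranking [set p : A * A | (p.2, p.1) \in ranking_set r].
Proof.
have /is_rankingP[tot anti tr] := ranking_setP r.
apply/is_rankingP; rewrite /rel_of_set; split.
- by move=> x y; rewrite !inE; apply: tot.
- by move=> x y; rewrite !inE andbC; apply: anti.
- by move=> y x z; rewrite !inE /= => xy yz; apply: tr yz xy.
Qed.

Definition opposite (A : finType) (r : ranking A) : ranking A :=
  Ranking (opposite_is_ranking r).

Lemma prefers_opposite (A : finType) (r : ranking A) (x y : A) :
  prefers (opposite r) x y = prefers r y x.
Proof. by rewrite /prefers /rel_of_set inE eq_sym. Qed.

(** The differing voters move from [R] to [R'] one at a time. Each still reports [v] just before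
    moving, so no single move decreases the distance from [v] to the outcome. *)
Lemma strategyproof_coalition (A : finType) (n : nat) (f : swf A n)
    (v : ranking A) (R R' : profile A n) :
  strategyproof f -> (forall j, R j != R' j -> R j = v) ->
  kemeny v (f R) <= kemeny v (f R').
Proof.
move=> spf; elim: {R}_.+1 {-2}R (ltnSn #|[set j | R j != R' j]|) => // d IH R.
move=> dR RR'.
case: (pickP (fun j => R j != R' j)) => [i Ri | RE]; last first.
  suff -> : R = R' by [].
  by apply/ffunP => j; move/negbFE/eqP: (RE j).
pose S : profile A n := [ffun j => if j == i then R' j else R j].
apply: (@leq_trans (kemeny v (f S))).
  rewrite -(RR' i Ri); apply: spf => j ji; rewrite ffunE (negbTE ji) //.
apply: IH => [|j]; last first.
  by rewrite ffunE; case: (j == i); [rewrite eqxx | apply: RR'].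
rewrite -ltnS; apply: leq_trans dR; rewrite ltnS.
apply: proper_card; apply/properP; split.
  by apply/subsetP => j; rewrite !inE ffunE; case: (j == i); rewrite // eqxx.
by exists i; rewrite !inE // ffunE !eqxx.
Qed.

(** Words are lists over {0, 1, 2, 3}; the number [i] stands for [alt x0 i]. *)
Definition alt (A : finType) (x0 : A) (i : nat) : A := nth x0 (enum A) i.

Definition word (A : finType) (x0 : A) (w : seq nat) : ranking A :=
  rank_of (map (alt x0) w).

Definition words : seq (seq nat) := permutations (iota 0 4).

Definition before (w : seq nat) (i j : nat) : bool := index i w < index j w.

Definition squares : seq (nat * nat) :=
  [seq (i, j) | i <- iota 0 4, j <- iota 0 4].

(** The Kemeny distance on four alternatives, in a form that computes. *)
Definition dist (v u : seq nat) : nat :=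
  count (fun p => before v p.1 p.2 && before u p.2 p.1) squares.

Lemma squaresP (i j : nat) : ((i, j) \in squares) = (i < 4) && (j < 4).
Proof.
apply/allpairsP/andP => [[[i' j'] []]|[i4 j4]].
  by rewrite !mem_iota => /= i4 j4 [-> ->].
by exists (i, j); rewrite !mem_iota.
Qed.

Lemma words_mem (w : seq nat) (i : nat) : w \in words -> (i \in w) = (i < 4).
Proof. by rewrite mem_permutations => /perm_mem ->; rewrite mem_iota. Qed.

Lemma sum_periodic (F : nat -> nat) (k s : nat) :
  \sum_(0 <= j < k * s) F (j %% s) = k * \sum_(0 <= j < s) F j.
Proof.
elim: k => [|k IH]; first by rewrite !mul0n big_geq.
rewrite mulSn addnC (big_cat_nat (n := k * s)) ?leq_addr //= IH mulSn addnC.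
congr addn; rewrite -{1}[k * s]add0n big_addn addKn.
by apply: eq_big_nat => j /= js; rewrite addnC modnMDl modn_small.
Qed.

(** Among [l.*2] consecutive indices exactly [l] are odd, whatever the parity of the first; the
    opposite pairs may thus start at an odd index. *)
Lemma sum_alternating (a b m l : nat) :
  \sum_(m <= j < m + l.*2) (if odd j then a else b) = l * (a + b).
Proof.
elim: l => [|l IH]; first by rewrite addn0 big_geq.
rewrite doubleS !addnS !big_nat_recr ?leq_addr ?(leqW (leq_addr _ _)) //= IH.
by case: (odd _) => /=; lia.
Qed.

(** * Rankings of all alternatives induced by words *)

Section Words.

Context (A : finType) (x0 : A) (hA : 4 <= #|A|).

Local Notation alt := (alt x0).
Local Notation word := (word x0).

Lemma alt_eq (i j : nat) : i < 4 -> j < 4 -> (alt i == alt j) = (i == j).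
Proof.
by move=> i4 j4; rewrite nth_uniq ?enum_uniq // -cardE (leq_trans _ hA).
Qed.

Definition top : pred A := fun x => index x (enum A) < 4.

Lemma topE (x : A) : top x -> exists2 i, i < 4 & x = alt i.
Proof.
by move=> hx; exists (index x (enum A)); rewrite // /alt nth_index ?mem_enum.
Qed.

Lemma top_alt (i : nat) : i < 4 -> top (alt i).
Proof.
by move=> i4; rewrite /top /alt index_uniq ?enum_uniq // -cardE (leq_trans i4).
Qed.

Lemma index_map_alt (w : seq nat) (i : nat) : all (gtn 4) w -> i < 4 ->
  index (alt i) (map alt w) = index i w.
Proof.
move=> + i4; elim: w => //= j w IH /andP[j4 /IH->].
by rewrite alt_eq.
Qed.

Lemma index_word (w : seq nat) (i : nat) : w \in words -> i < 4 ->
  index (alt i) (map alt w ++ enum A) = index i w.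
Proof.
move=> hw i4; rewrite index_cat map_f ?(words_mem _ hw) //.
by apply: index_map_alt => //; apply/allP => j; rewrite (words_mem _ hw).
Qed.

Lemma index_word_bottom (w : seq nat) (x : A) : w \in words -> ~~ top x ->
  index x (map alt w ++ enum A) = 4 + index x (enum A).
Proof.
move=> hw hx; rewrite index_cat; case: mapP => [[i hi xi]|_].
  by case/negP: hx; rewrite xi top_alt // -(words_mem _ hw).
by move: hw; rewrite size_map mem_permutations => /perm_size ->.
Qed.

Lemma prefers_word (w : seq nat) (i j : nat) : w \in words -> i < 4 -> j < 4 ->
  prefers (word w) (alt i) (alt j) = before w i j.
Proof. by move=> hw i4 j4; rewrite prefers_rank_of !index_word. Qed.

(** Every word puts the first four elements of [enum A] above the rest and keeps the rest in order,
    so all words agree on these pairs. *)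
Lemma prefers_word_bottom (w : seq nat) (x y : A) : w \in words ->
  ~~ (top x && top y) ->
  prefers (word w) x y = (index x (enum A) < index y (enum A)).
Proof.
move=> hw; rewrite prefers_rank_of.
have le4 i : i < 4 -> index i w < 4.
  have sw : size w = 4 by move: hw; rewrite mem_permutations => /perm_size.
  by move=> i4; rewrite -sw index_mem (words_mem _ hw).
have aux a b c : a < 4 -> b < 4 -> ~~ (c < 4) ->
    ((a < 4 + c) = (b < c)) * ((4 + c < a) = (c < b)) by split; lia.
case hx: (top x); case hy: (top y) => //= _.
- have [i i4 xi] := topE hx.
  rewrite (index_word_bottom hw (negbT hy)) [in LHS]xi index_word //.
  by rewrite (aux _ _ _ (le4 i i4) hx (negbT hy)).
- have [i i4 yi] := topE hy.
  rewrite (index_word_bottom hw (negbT hx)) [in LHS]yi index_word //.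
  by rewrite (aux _ _ _ (le4 i i4) hy (negbT hx)).
- by rewrite !index_word_bottom ?hx ?hy // ltn_add2l.
Qed.

Definition agrees (u : seq nat) (r : ranking A) : Prop :=
  forall i j, i < 4 -> j < 4 -> prefers r (alt i) (alt j) = before u i j.

(** The word is obtained by sorting the four indices by [r]. *)
Lemma agreeing_word (r : ranking A) : exists2 u, u \in words & agrees u r.
Proof.
have /is_rankingP[tot _ tr] := ranking_setP r.
pose e : rel nat := fun i j => rel_of_set r (alt i) (alt j).
have hu : sort e (iota 0 4) \in words by rewrite mem_permutations perm_sort.
exists (sort e (iota 0 4)) => // i j i4 j4.
have su : sorted e (sort e (iota 0 4)) by apply: sort_sorted => x y; apply: tot.
have tre : transitive e by move=> x y z; apply: tr.
have ltP k l : k < 4 -> l < 4 -> before (sort e (iota 0 4)) k l ->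
    prefers r (alt k) (alt l).
  move=> k4 l4 kl; rewrite /prefers alt_eq //.
  rewrite (_ : k != l) /=; last first.
    by apply: contraTneq kl => ->; rewrite /before ltnn.
  by apply: (sorted_ltn_index tre su) kl; rewrite (words_mem _ hu).
have [<-|ij] := eqVneq i j; first by rewrite /prefers /before eqxx ltnn.
apply/idP/idP; last exact: ltP.
apply: contraLR; rewrite -prefers_total ?alt_eq // => nij.
apply: ltP => //; move: nij; rewrite /before -leqNgt leq_eqVlt.
case/orP=> // /eqP ji; move: ij.
by rewrite -(index_inj 0 _ _ ji) ?eqxx // (words_mem _ hu).
Qed.

(** The disagreements of [r] with any word on pairs that are not both at the top, where all words
    follow [enum A]. *)
Definition outer_dist (r : ranking A) : nat :=
  #|[set p : A * A | (index p.1 (enum A) < index p.2 (enum A))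
      && prefers r p.2 p.1 && ~~ (top p.1 && top p.2)]|.

(** The part of the distance outside the four top alternatives does not depend
    on [v]. *)
Lemma kemeny_word (v u : seq nat) (r : ranking A) :
  v \in words -> agrees u r -> kemeny (word v) r = dist v u + outer_dist r.
Proof.
move=> hv ur; rewrite /kemeny -(cardsID [set p | top p.1 && top p.2]).
congr addn; last first.
  apply: eq_card => -[x y]; rewrite !inE /= andbC.
  case hxy: (top x && top y); rewrite ?andbF // !andbT.
  by rewrite prefers_word_bottom ?hxy.
pose s := [seq (alt p.1, alt p.2) | p <- squares].
pose P (p : A * A) := prefers (word v) p.1 p.2 && prefers r p.2 p.1.
have us : uniq s.
  rewrite map_inj_in_uniq // => -[i j] [k l]; rewrite !squaresP.
  move=> /andP[i4 j4] /andP[k4 l4] [/eqP + /eqP]; rewrite !alt_eq //.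
  by move=> /eqP-> /eqP->.
transitivity (count P s); last first.
  rewrite count_map; apply: eq_in_count => -[i j]; rewrite squaresP => /andP[? ?].
  by rewrite /P /= prefers_word // ur.
rewrite -size_filter -(card_uniqP (filter_uniq P us)).
apply: eq_card => -[x y]; rewrite !inE mem_filter /P /=; congr andb.
apply/andP/mapP => [[hx hy]|[[i j]]].
  have [i i4 ->] := topE hx; have [j j4 ->] := topE hy.
  by exists (i, j); rewrite ?squaresP ?i4.
by rewrite squaresP => /andP[i4 j4] [-> ->]; rewrite !top_alt.
Qed.

(** A word follows [enum A] outside the top, so its outer distance is 0. *)
Lemma kemeny_words (v t : seq nat) :
  v \in words -> t \in words -> kemeny (word v) (word t) = dist v t.
Proof.
move=> hv ht; rewrite (@kemeny_word v t) => //; last first.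
  by move=> i j i4 j4; rewrite prefers_word.
rewrite [outer_dist _]eq_card0 ?addn0 // => -[x y]; rewrite !inE /=.
case hxy: (top x && top y); rewrite ?andbF // prefers_word_bottom //.
  by case: ltngtP.
by rewrite andbC hxy.
Qed.


(** The voters after the first [k * size W] alternate between two opposite
    rankings and so cancel out in majority comparisons. *)
Definition cloned (n k : nat) (W : seq (seq nat)) : profile A n :=
  [ffun j : 'I_n =>
    if j < k * size W then word (nth [::] W (j %% size W))
    else if odd j then opposite (word [::]) else word [::]].

(** Each pair of opposite voters contributes exactly one voter to either comparison, whence the
    summand [l]. *)
Lemma card_cloned (n k l : nat) (W : seq (seq nat)) (x y : A) :
  x != y -> n = k * size W + l.*2 ->
  #|[set i | prefers (cloned n k W i) x y]|
  = k * count (fun w => prefers (word w) x y) W + l.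
Proof.
move=> xy nE.
pose F w : nat := prefers (word w) x y.
pose G j : nat := if j < k * size W then F (nth [::] W (j %% size W))
  else if odd j then prefers (word [::]) y x : nat else F [::].
transitivity (\sum_(0 <= j < n) G j).
  rewrite big_mkord -sum1_card big_mkcond; apply: eq_bigr => i _.
  rewrite inE ffunE /G /F; case: (i < _); first by case: prefers.
  by case: (odd i); rewrite ?prefers_opposite; case: prefers.
rewrite {}nE (big_cat_nat (n := k * size W)) ?leq_addr //=; congr addn.
  under eq_big_nat => j /= jk do rewrite /G jk.
  rewrite (sum_periodic (fun j => F (nth [::] W j))) -(big_nth [::] xpredT F).
  by rewrite -sum1_count [in RHS]big_mkcond.
under eq_big_nat => j /andP[jk _] do rewrite /G ltnNge jk /=.
by rewrite sum_alternating /F (prefers_total _ xy); case: prefers; rewrite muln1.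
Qed.

(** * Outcomes at cloned profiles *)

Section Cloned.

Context (n k l : nat) (f : swf A n).
Context (k_gt0 : 0 < k) (nE : n = k * 9 + l.*2).
Context (spf : strategyproof f) (mcf : majority_consistent f).

Definition outcome (W : seq (seq nat)) : ranking A := f (cloned n k W).

(** More than four of nine words form a strict majority. *)
Definition majority_word (W : seq (seq nat)) (t : seq nat) : bool :=
  [&& size W == 9, all (mem words) W, t \in words
    & all (fun p => before t p.1 p.2 ==>
             (4 < count (fun w => before w p.1 p.2) W)) squares].

Lemma outcome_majority (W : seq (seq nat)) (t : seq nat) :
  majority_word W t -> outcome W = word t.
Proof.
case/and4P=> /eqP sW /allP hW ht /allP maj.
have large x y : prefers (word t) x y ->
    4 < count (fun w => prefers (word w) x y) W.
  case hxy: (top x && top y).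
    case/andP: hxy => /topE[i i4 ->] /topE[j j4 ->].
    rewrite prefers_word // => tij.
    rewrite (@eq_in_count _ _ (fun w => before w i j)); last first.
      by move=> w /hW hw; rewrite prefers_word.
    by have := maj (i, j); rewrite squaresP i4 j4 /= tij; apply.
  rewrite prefers_word_bottom ?hxy // => xy.
  (* Outside the top the nine words are unanimous. *)
  rewrite (_ : count _ _ = 9) // -sW; apply/eqP; rewrite -all_count.
  by apply/allP => w /hW hw; rewrite prefers_word_bottom ?hxy.
have majE : majority (cloned n k W) =2 rel_of_set (word t).
  move=> x y; have [->|xy] := eqVneq x y.
    have /is_rankingP[tot _ _] := ranking_setP (word t).
    by rewrite /majority leqnn; move: (tot y y); rewrite orbb.
  rewrite /majority !(@card_cloned n k l) ?sW // 1?eq_sym // leq_add2r.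
  rewrite leq_pmul2l //.
  have yxE : count (fun w => prefers (word w) y x) W
      = 9 - count (fun w => prefers (word w) x y) W.
    rewrite -sW -(count_predC (fun w => prefers (word w) x y) W) addKn.
    by apply: eq_count => w /=; rewrite (prefers_total _ xy).
  have -> : rel_of_set (word t) x y = prefers (word t) x y.
    by rewrite /prefers xy.
  case txy: (prefers (word t) x y).
    by move: (large _ _ txy); rewrite yxE; lia.
  have /large : prefers (word t) y x by rewrite (prefers_total _ xy) txy.
  by rewrite yxE; lia.
have /is_rankingP[_ anti tr] := ranking_setP (word t).
apply: ranking_ext => x y; rewrite /outcome mcf ?majE //.
- by move=> a b c; rewrite !majE; apply: tr.
- by move=> a b; rewrite !majE; apply: anti.
Qed.

(** The clones of the [i]-th word form a coalition with a common ranking both before and after the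
    change, which gives one inequality in each direction. *)
Lemma outcome_deviation (W : seq (seq nat)) (i : nat) (w : seq nat) :
  size W = 9 -> i < 9 ->
  kemeny (word (nth [::] W i)) (outcome W)
    <= kemeny (word (nth [::] W i)) (outcome (set_nth [::] W i w))
  /\ kemeny (word w) (outcome (set_nth [::] W i w))
    <= kemeny (word w) (outcome W).
Proof.
move=> sW i9.
have sW' : size (set_nth [::] W i w) = 9.
  by rewrite size_set_nth sW; apply/maxn_idPr.
split; apply: strategyproof_coalition => // j; rewrite !ffunE sW sW';
  case: ifP => _; rewrite ?eqxx // nth_set_nth /=;
  by case: (eqVneq (j %% 9) i) => [->|_] //; rewrite eqxx.
Qed.

(** A deviation [(i, w, t)] replaces the [i]-th word by [w], after which the
    majority ranking is [t]. [u] and [e] range over the possible restrictions of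
    the outcome to the top alternatives and over its outer distances. *)
Definition pinned (W : seq (seq nat)) (devs : seq (nat * seq nat * seq nat))
    (o : seq nat) : bool :=
  [&& devs != [::], all (fun d => [&& d.1.1 < 9, nth [::] W d.1.1 \in words,
          d.1.2 \in words
        & majority_word (set_nth [::] W d.1.1 d.1.2) d.2]) devs
    & all (fun u => all (fun e =>
        all (fun d => let v := nth [::] W d.1.1 in
          (dist v u + e <= dist v d.2)
          && (dist d.1.2 d.2 <= dist d.1.2 u + e)) devs
        ==> (u == o) && (e == 0)) (iota 0 (size squares).+1)) words].

Lemma kemeny_pinned (W : seq (seq nat)) (devs : seq (nat * seq nat * seq nat))
    (o v : seq nat) :
  size W = 9 -> pinned W devs o -> v \in words ->
  kemeny (word v) (outcome W) = dist v o.
Proof.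
move=> sW /and3P[devs0 /allP hdevs /allP pin] hv.
have [u hu ur] := agreeing_word (outcome W).
pose e := outer_dist (outcome W).
have step d : d \in devs -> let v := nth [::] W d.1.1 in
    dist v u + e <= dist v d.2 /\ dist d.1.2 d.2 <= dist d.1.2 u + e.
  case: d => [[i w] t] /hdevs /and4P[/= i9 hWi hw maj].
  have [] := outcome_deviation w sW i9.
  have /and4P[_ _ ht _] := maj.
  by rewrite (outcome_majority maj) !(kemeny_word _ ur) // !kemeny_words.
(* A single deviation bounds the outer distance by a value of [dist], hence by the number of
   squares, so the finite check in [pinned] covers it. *)
have e_le : e \in iota 0 (size squares).+1.
  case: devs devs0 step {hdevs pin} => // d devs _ /(_ d (mem_head _ _))[le_e _].
  rewrite mem_iota ltnS; apply: leq_trans (count_size _ _).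
  by apply: leq_trans le_e; apply: leq_addl.
have /allP/(_ e e_le)/implyP pin_ue := pin u hu.
have /pin_ue/andP[/eqP uo /eqP e0] : all (fun d => let v' := nth [::] W d.1.1 in
    (dist v' u + e <= dist v' d.2)
    && (dist d.1.2 d.2 <= dist d.1.2 u + e)) devs.
  by apply/allP => d /step[/= -> ->].
by rewrite (kemeny_word hv ur) -/e uo e0 addn0.
Qed.

End Cloned.

End Words.

(** * The two pinned profiles and the contradiction *)

Theorem theorem1 (m n : nat) (hm : 4 <= m) (hn : 9 <= n)
    (hn' : n \notin [:: 10; 12; 14; 16])
    (A : finType) (hA : #|A| = m) :
  ~ exists f : swf A n, strategyproof f /\ majority_consistent f.
Proof.
case=> f [spf mcf]; have A4 : 4 <= #|A| by rewrite hA.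
have [x0 _] : exists x : A, x \in A by apply/card_gt0P; apply: leq_trans A4.
(* [k] must have the parity of [n]. For even [n], [k = 2] requires [18 <= n], which the excluded
   values guarantee. *)
have [k [l [k_gt0 nE]]] : exists k l, 0 < k /\ n = k * 9 + l.*2.
  case: (boolP (odd n)) => n_odd.
    by exists 1, (n - 9)./2; split; lia.
  exists 2, (n - 18)./2; split=> //.
  suff : 18 <= n by lia.
  move: hn'; rewrite !inE; lia.
(* [W] and the deviations below were found by a computer search. *)
pose W : seq (seq nat) :=
  [:: [:: 0; 1; 2; 3]; [:: 0; 1; 2; 3]; [:: 1; 3; 2; 0]; [:: 2; 0; 3; 1];
      [:: 2; 1; 3; 0]; [:: 2; 3; 0; 1]; [:: 2; 3; 1; 0]; [:: 3; 0; 1; 2];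
      [:: 3; 1; 0; 2]].
(* This is cabd; it will replace cadb, the word at index 3 of [W]. *)
pose w := [:: 2; 0; 1; 3].
have pinW : pinned W [:: (0, [:: 0; 2; 1; 3], [:: 2; 3; 0; 1]);
    (5, [:: 2; 1; 0; 3], [:: 1; 2; 3; 0]);
    (7, [:: 0; 3; 2; 1], [:: 2; 3; 0; 1])] [:: 2; 3; 0; 1].
  by vm_compute.
have pinW' : pinned (set_nth [::] W 3 w)
    [:: (0, [:: 0; 3; 2; 1], [:: 2; 3; 0; 1]);
    (5, [:: 3; 2; 1; 0], [:: 1; 2; 3; 0]);
    (7, [:: 1; 0; 3; 2], [:: 1; 2; 3; 0])] [:: 1; 2; 3; 0].
  by vm_compute.
(* The inequality kept has cabd as the true ranking; with both outcomes pinned it reads [3 <= 2]. *)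
have [_] := outcome_deviation x0 k spf w (erefl : size W = 9) (isT : 3 < 9).
rewrite (kemeny_pinned x0 A4 k_gt0 nE spf mcf _ pinW) //.
by rewrite (kemeny_pinned x0 A4 k_gt0 nE spf mcf _ pinW').
Qed.
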